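(* Let $a\in A$, $a\neq 0$, and suppose that $Ka$ is Kummer. Then $H=\{1\}$, $G$ is cyclic of order $n$ with a generator $g$, and $KaK=Ku$ for an invertible $u\in KaK$ satisfying $uku^{-1}=g(k)$ for all $k\in K$. If $a$ is invertible, we may take $u=a$.
   Context: Setting: $F$ is a field, $A$ is a central simple $F$-algebra of degree $n$ (so $\dim_F A=n^2$), and $K\subset A$ is a maximal subfield, separable over $F$, with $n=[K:F]$. $L$ is the Galois closure of $K/F$, $G=\mathrm{Gal}(L/F)$, $H=\mathrm{Gal}(L/K)$. $KaK$ denotes the $F$-span of all $kak'$ with $k,k'\in K$. For $x\in A$, $(-1)^i\rho_i(x)$ is the coefficient of $t^{n-i}$ in the (reduced) characteristic polynomial of $x$. An $F$-vector space $V\subseteq A$ is Kummer if $\rho_i(v)=0$ for every $v\in V$ and every $i\in\{1,\dots,n-1\}$. *)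

(* Defs.v *)
From HB Require Import structures.
From mathcomp Require Import all_boot all_order all_algebra.
From mathcomp Require Import all_fingroup all_solvable all_field.
From mathcomp Require classical_sets.

Set Implicit Arguments.
Unset Strict Implicit.
Unset Printing Implicit Defensive.

Import GRing.Theory.
Local Open Scope ring_scope.

(* Two-sided ideals of a unital F-algebra are F-subspaces, hence the
   quantification over {vspace A}.  A falgType is nonzero. *)
Definition simple_alg (F : fieldType) (A : falgType F) : Prop :=
  forall I : {vspace A},
    ({:A} * I <= I)%VS -> (I * {:A} <= I)%VS -> I = 0%VS \/ I = fullv.

Definition central_simple (F : fieldType) (A : falgType F) (n : nat) : Prop :=
  [/\ 'Z({:A})%VS = 1%VS, simple_alg A & \dim {:A} = (n ^ 2)%N].

(* An {aspace A} may have an identity other than 1, hence the first clause. *)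
Definition is_subfield (F : fieldType) (A : falgType F)
    (E : {aspace A}) : Prop :=
  [/\ 1 \in E,
      {in E &, forall x y, x * y = y * x}
    & {in E, forall x, x != 0 -> x \is a GRing.unit /\ x^-1 \in E}].

(* A subfield of A containing E contains F, so it is again an {aspace A}. *)
Definition maximal_subfield (F : fieldType) (A : falgType F)
    (E : {aspace A}) : Prop :=
  is_subfield E /\
  forall E' : {aspace A}, is_subfield E' -> (E <= E')%VS -> E' = E.

(* phi is x |-> theta (x (x) 1) for an isomorphism theta of E-algebras from
   A (x)_F E onto 'M_n(E): such a theta is the same thing as an F-algebra
   morphism phi sending an F-basis of A to an E-basis of 'M_n(E). *)
Definition splitting (F : fieldType) (A : falgType F) (n : nat)
    (E : fieldType) (f : {rmorphism F -> E})
    (phi : {rmorphism A -> 'M[E]_n}) : Prop :=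
  (forall (c : F) (x : A), phi (c *: x) = f c *: phi x) /\
  bijective (fun c : 'rV[E]_(\dim {:A}) =>
    \sum_(i < \dim {:A}) c 0 i *: phi (vbasis {:A})`_i).

Definition is_red_char_poly (F : fieldType) (A : falgType F) (n : nat)
    (x : A) (p : {poly F}) : Prop :=
  exists (E : fieldType) (f : {rmorphism F -> E})
         (phi : {rmorphism A -> 'M[E]_n}),
    splitting f phi /\ map_poly f p = char_poly (phi x).

(* For A central simple of degree n there is exactly one such polynomial;
   the default value 0 is then irrelevant. *)
Definition red_char_poly (F : fieldType) (A : falgType F) (n : nat)
    (x : A) : {poly F} :=
  classical_sets.xget 0 (is_red_char_poly n x).

Definition rho (F : fieldType) (A : falgType F) (n i : nat) (x : A) : F :=
  (-1) ^+ i * (red_char_poly n x)`_(n - i).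

Definition kummer (F : fieldType) (A : falgType F) (n : nat)
    (V : {vspace A}) : Prop :=
  forall v, v \in V -> forall i, (1 <= i <= n.-1)%N -> rho n i v = 0.

Definition galois_closure (F : fieldType) (L : splittingFieldType F)
    (K : {vspace L}) : Prop :=
  galois 1 {:L} /\
  forall E : {subfield L},
    (K <= E)%VS -> galois 1 E -> (E : {vspace L}) = fullv.

(* K sits in A literally and in its Galois closure L through iota, so the
   element g(k) of K is the k' with iota k' = g (iota k). *)
Definition KaK_generator (F : fieldType) (A : falgType F)
    (K : {aspace A}) (L : splittingFieldType F)
    (iota : 'AHom(subvs_of K, L)) (a : A) (g : gal_of {:L}) (u : A) : Prop :=
  [/\ u \in (K * <[a]> * K)%VS,
      u \is a GRing.unit,
      (K * <[a]> * K)%VS = (K * <[u]>)%VS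
    & forall k : subvs_of K, exists k' : subvs_of K,
        iota k' = g (iota k) /\ u * vsval k * u^-1 = vsval k'].

(* Main.v *)
Require Import Defs.
From HB Require Import structures.
From mathcomp Require Import all_boot all_order all_algebra.
From mathcomp Require Import all_fingroup all_solvable all_field.
From mathcomp Require classical_sets.
From mathcomp Require Import ring.

(** After extension of scalars to L the algebra A becomes the matrix algebra of
    size n, and the basis can be chosen so that every k in K becomes the
    diagonal matrix of its conjugates, listed as h_i (iota k) with h_i in
    Gal(L/F) ([subfield_diag_splitting]).  Let (a_ij) be the matrix of a, and
    draw an arrow from i to j when a_ij is nonzero.

    The characteristic polynomial of ka is expressed through the principal
    minors of (a_ij): its coefficient of t^(n-m) is, up to sign, the sum over
    the sets S of size m of the minor on S times the product over S of the
    conjugates of k.  These products are linearly independent functions of k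
    ([multiaffine_eq0], by repeated differences and the independence of the
    conjugates, which covers finite fields as well), so the Kummer condition
    says that all principal minors of sizes 1, ..., n-1 vanish
    ([kummer_pminor]).

    The graph is invariant under Gal(L/F), because a is rational over F: the
    component of a on the i-th and j-th idempotents of K (x) L is carried by
    g to the component on the idempotents permuted by g
    ([splitting_support_invariant]).  The Galois group permutes the conjugates
    transitively and a is nonzero, so every vertex has an outgoing arrow.  A
    smallest nonempty set of vertices that can be followed forever inside
    itself is a cycle without chords, whose principal minor is a single
    nonzero product; hence it contains all n vertices ([cyclic_pattern]).  So
    the graph is one cycle i -> f(i) through all vertices.

    Each element of the Galois group commutes with f, thus is determined by
    the image of one vertex: an element that fixes one conjugate of a generator
    of K fixes them all.  Therefore K is normal over F, its Galois closure is
    K itself, and the group is generated by the element g that acts as f.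
    Comparing matrix entries gives a k = g(k) a, and a monomial matrix is
    invertible, so u = a always works.

    The reduced characteristic polynomial is defined through an unspecified
    splitting.  It is controlled by the identity P^n = Q, where P is the
    characteristic polynomial of the image of x in a splitting and Q that of
    the multiplication by x on A ([splitting_char_poly]): a monic polynomial
    is determined by its n-th power, which gives both the independence of the
    splitting and, over the Galois extension L, the rationality of P
    ([red_char_polyE]).  The existence of the splitting rests on the linear
    independence of the maps x |-> b_i x b_j on a central simple algebra
    ([bimodule_indep]). *)

Set Implicit Arguments.
Unset Strict Implicit.
Unset Printing Implicit Defensive.

Import GRing.Theory.
Local Open Scope ring_scope.

(** * Relations between left and right multiplications *)

Definition lin_indep (F : fieldType) (V : lmodType F) (I : finType)
    (X : I -> V) : Prop :=
  forall c : I -> F, \sum_i c i *: X i = 0 -> forall i, c i = 0.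

(** An induction principle for products of subspaces, which avoids choosing a
    decomposition of an element into products. *)
Lemma prodv_ind (F : fieldType) (A : falgType F) (U V : {vspace A})
    (P : A -> Prop) :
    P 0 -> (forall x y, P x -> P y -> P (x + y)) ->
    (forall u v, u \in U -> v \in V -> P (u * v)) ->
  forall w, w \in (U * V)%VS -> P w.
Proof.
move=> P0 PD PM w; rewrite unlock => /coord_span->.
apply: (big_ind P) => // i _.
have /allpairsP[[u v] /= [Uu Vv ->]] :
    [seq u * v | u <- vbasis U, v <- vbasis V]`_i
      \in [seq u * v | u <- vbasis U, v <- vbasis V].
  by rewrite mem_nth // size_allpairs !size_tuple.
by rewrite scalerAl; apply: PM; [apply/memvZ/vbasis_mem|apply: vbasis_mem].
Qed.

(** A shortest relation sum_i X_i x c_i = 0 can be multiplied and added to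
    itself until its first coefficient is 1, since the ideal generated by that
    coefficient is everything; commuting it with y then kills the first term
    and shows that the coefficients are central, hence scalars. *)
Lemma bimodule_indep (F : fieldType) (A : falgType F) r (X c : 'I_r -> A) :
    'Z({:A})%VS = 1%VS -> simple_alg A -> lin_indep X ->
    (forall x, \sum_i X i * x * c i = 0) ->
  forall i, c i = 0.
Proof.
move=> ZA simpA; elim: r X c => [|r IHr] X c Xind cX; first by case.
have indX' : lin_indep (X \o lift ord0).
  move=> d dX i.
  pose e j := if unlift ord0 j is Some k then d k else 0.
  have := Xind e; rewrite big_ord_recl /e unlift_none scale0r add0r.
  under eq_bigr do rewrite liftK.
  by move=> /(_ dX (lift ord0 i)); rewrite liftK.
have [c00 | nz_c0] := eqVneq (c ord0) 0.
  have c'0: forall i, (c \o lift ord0) i = 0.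
    apply: (IHr (X \o lift ord0)) => // x.
    by have := cX x; rewrite big_ord_recl c00 mulr0 add0r.
  by move=> i; case: (unliftP ord0 i) => [j ->|->]; [apply: c'0|].
(* P z: some relation has z as its first coefficient. *)
pose P z := exists2 d : 'I_r.+1 -> A, d ord0 = z
              & forall x, \sum_i X i * x * d i = 0.
have PD x y : P x -> P y -> P (x + y).
  move=> [d <- dX] [e <- eX]; exists (fun i => d i + e i) => // z.
  by under eq_bigr do rewrite mulrDr; rewrite big_split /= dX eX addr0.
have P0 : P 0.
  by exists (fun=> 0) => // x; rewrite big1 // => i _; rewrite mulr0.
have I1 : ({:A} * <[c ord0]> * {:A})%VS = fullv.
  have [||I0|//] := simpA ({:A} * <[c ord0]> * {:A})%VS.
  - by rewrite !prodvA !prodvSl ?subvf.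
  - by rewrite -prodvA prodvSr ?subvf.
  have: c ord0 \in ({:A} * <[c ord0]> * {:A})%VS.
    have := memv_mul (memv_mul (memvf 1) (memv_line (c ord0))) (memvf 1).
    by rewrite mul1r mulr1.
  by rewrite I0 memv0 (negPf nz_c0).
have [d d0 dX] : P 1.
  have: 1 \in ({:A} * <[c ord0]> * {:A})%VS by rewrite I1 memvf.
  elim/prodv_ind=> // u v + _; move: u.
  apply: (prodv_ind (P := fun u => P (u * v))).
  - by rewrite mul0r.
  - by move=> x y Px Py; rewrite mulrDl; apply: PD.
  move=> u _ _ /vlineP[k ->].
  exists (fun i => u * (k *: c i) * v) => // x.
  have := congr1 (fun w => k *: (w * v)) (cX (x * u)).
  rewrite mul0r scaler0 mulr_suml scaler_sumr => e0; rewrite -[RHS]e0.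
  by apply: eq_bigr => i _; rewrite -scalerAr -scalerAl -scalerAr !mulrA.
(* The commutator of the relation with y has first coefficient 0. *)
have dZ i : d i \in 1%VS.
  rewrite -ZA memv_cap memvf; apply/centvP => y _.
  case: (unliftP ord0 i) => [j ->|->]; last by rewrite d0 mulr1 mul1r.
  apply/eqP; rewrite -subr_eq0 -opprB oppr_eq0; apply/eqP.
  apply: (IHr (X \o lift ord0) (fun j => y * d (lift ord0 j)
            - d (lift ord0 j) * y)) => // x.
  have := dX (x * y); have := congr1 (fun w => w * y) (dX x).
  rewrite mul0r mulr_suml !big_ord_recl d0 !mulr1 => /eqP.
  rewrite addrC addr_eq0 => /eqP e1 /eqP.
  rewrite addrC addr_eq0 mulrA -e1 => /eqP e2.
  under eq_bigr do rewrite mulrBr !mulrA.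
  rewrite sumrB; apply/eqP; rewrite subr_eq0; apply/eqP; rewrite -e2.
  by apply: eq_bigr => k _; rewrite !mulrA.
have /(_ ord0)/vlineP[k0 dk0] := dZ.
have dE i : d i = (coord [tuple 1] ord0 (d i)) *: 1.
  have := dZ i; rewrite -span_seq1 => /(@coord_span _ _ _ [tuple 1]) {1}->.
  by rewrite big_ord1.
have := dX 1; under eq_bigr do rewrite mulr1 dE -scalerAr mulr1.
move/Xind/(_ ord0) => e; have := dE ord0.
by rewrite e scale0r d0 => /eqP; rewrite oner_eq0.
Qed.

(** The rank of a matrix does not change under extension of the field. *)
Lemma lin_indep_map (F L : fieldType) (f : {rmorphism F -> L}) (I : finType)
    p q (M : I -> 'M[F]_(p, q)) :
  lin_indep M -> lin_indep (fun i => map_mx f (M i)).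
Proof.
move=> Mind.
pose T := \matrix_(k < #|I|) mxvec (M (enum_val k)).
have sumT (K : fieldType) (g : {rmorphism F -> K}) (c : I -> K) :
    (\row_(k < #|I|) c (enum_val k)) *m map_mx g T
      = mxvec (\sum_i c i *: map_mx g (M i)).
  rewrite mulmx_sum_row linear_sum /=.
  rewrite [RHS](eq_bigl (fun i => i \in I)) // [RHS]big_enum_val.
  apply: eq_bigr => k _.
  by rewrite mxE -map_row rowK linearZ /= map_mxvec.
have Tfree : row_free T.
  apply: inj_row_free => v vT0; apply/rowP => k; rewrite mxE.
  have := Mind (fun i => v 0 (enum_rank i)).
  have:= sumT F idfun (fun i => v 0 (enum_rank i)).
  have -> : \row_k v 0 (enum_rank (enum_val k)) = v.
    by apply/rowP => j; rewrite mxE enum_valK.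
  rewrite map_mx_id // vT0.
  under eq_bigr do rewrite map_mx_id //.
  move=> /esym/(canRL mxvecK); rewrite linear0 => -> /(_ erefl (enum_val k)).
  by rewrite enum_valK.
move=> c c0 i.
have := sumT L f c; rewrite c0 linear0 => /eqP.
rewrite mulmx_free_eq0 ?row_free_map // => /eqP/rowP/(_ (enum_rank i)).
by rewrite !mxE enum_rankK.
Qed.

Section RegularRepresentation.

Variables (F : fieldType) (A : falgType F) (N : nat) (b : N.-tuple A).
Hypothesis basis_b : basis_of {:A} b.

(** Matrices act on row vectors, so that [rmx] is multiplicative and [lmx]
    reverses products. *)
Definition crd (x : A) : 'rV[F]_N := \row_j coord b j x.
Definition rmx (x : A) : 'M[F]_N := \matrix_i crd (b`_i * x).
Definition lmx (x : A) : 'M[F]_N := \matrix_i crd (x * b`_i).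

Fact crd_is_linear : linear crd.
Proof. by move=> k x y; apply/rowP => j; rewrite !mxE linearD linearZ. Qed.
HB.instance Definition _ := GRing.isLinear.Build F A 'rV[F]_N *:%R crd
  crd_is_linear.

Fact rmx_is_linear : linear rmx.
Proof.
move=> k x y; apply/row_matrixP => i.
by rewrite [RHS]linearP /= !rowK mulrDr -scalerAr linearP.
Qed.
HB.instance Definition _ := GRing.isLinear.Build F A 'M[F]_N *:%R rmx
  rmx_is_linear.

Fact lmx_is_linear : linear lmx.
Proof.
move=> k x y; apply/row_matrixP => i.
by rewrite [RHS]linearP /= !rowK mulrDl -scalerAl linearP.
Qed.
HB.instance Definition _ := GRing.isLinear.Build F A 'M[F]_N *:%R lmx
  lmx_is_linear.

Lemma crdE x : x = \sum_i crd x 0 i *: b`_i.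
Proof.
rewrite {1}(coord_basis basis_b (memvf x)).
by apply: eq_bigr => i _; rewrite mxE.
Qed.

Lemma crd_inj : injective crd.
Proof. by move=> x y e; rewrite (crdE x) (crdE y) e. Qed.

Lemma crd_basis (i : 'I_N) : crd b`_i = delta_mx 0 i.
Proof.
by apply/rowP => j; rewrite !mxE coord_free ?(basis_free basis_b) // eq_sym.
Qed.

Lemma crd_rmx y x : crd y *m rmx x = crd (y * x).
Proof.
rewrite mulmx_sum_row {2}(crdE y) mulr_suml linear_sum.
by apply: eq_bigr => i _; rewrite rowK -scalerAl linearZ.
Qed.

Lemma crd_lmx y x : crd y *m lmx x = crd (x * y).
Proof.
rewrite mulmx_sum_row {2}(crdE y) mulr_sumr linear_sum.
by apply: eq_bigr => i _; rewrite rowK -scalerAr linearZ.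
Qed.

Lemma crd_mxP m (M M' : 'M[F]_(N, m)) :
  (forall x, crd x *m M = crd x *m M') -> M = M'.
Proof.
by move=> e; apply/row_matrixP => i; rewrite !rowE -crd_basis.
Qed.

Lemma rmxM x y : rmx (x * y) = rmx x *m rmx y.
Proof. by apply: crd_mxP => z; rewrite mulmxA !crd_rmx mulrA. Qed.

Lemma lmxM x y : lmx (x * y) = lmx y *m lmx x.
Proof. by apply: crd_mxP => z; rewrite mulmxA !crd_lmx mulrA. Qed.

Lemma rmx1 : rmx 1 = 1%:M.
Proof. by apply: crd_mxP => z; rewrite crd_rmx mulr1 mulmx1. Qed.

Lemma lmx1 : lmx 1 = 1%:M.
Proof. by apply: crd_mxP => z; rewrite crd_lmx mul1r mulmx1. Qed.

Lemma lmx_rmxC x y : lmx x *m rmx y = rmx y *m lmx x.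
Proof. by apply: crd_mxP => z; rewrite !mulmxA !(crd_lmx, crd_rmx) mulrA. Qed.

(** Central simplicity in matrix form; together with [lin_indep_map] it replaces
    the simplicity of the scalar extension of A. *)
Lemma lmx_rmx_indep r s (X : 'I_r -> A) (Y : 'I_s -> A) :
    'Z({:A})%VS = 1%VS -> simple_alg A -> lin_indep X -> lin_indep Y ->
  lin_indep (fun ij : 'I_r * 'I_s => lmx (X ij.1) *m rmx (Y ij.2)).
Proof.
move=> ZA simpA indX indY c c0 [i j].
apply: (indY (fun j => c (i, j))) j.
apply: (bimodule_indep (c := fun i => \sum_j c (i, j) *: Y j) ZA simpA indX).
move=> x; apply: crd_inj; rewrite linear0.
have := congr1 (mulmx (crd x)) c0; rewrite mulmx0 mulmx_sumr => e0.
rewrite -[RHS]e0.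
transitivity (\sum_i \sum_j
    crd x *m (c (i, j) *: (lmx (X i) *m rmx (Y j)))); last first.
  by rewrite pair_bigA; apply: eq_bigr => -[].
rewrite linear_sum.
apply: eq_bigr => k _; rewrite mulr_sumr linear_sum; apply: eq_bigr => l _.
by rewrite -scalemxAr mulmxA crd_lmx crd_rmx -scalerAr linearZ.
Qed.

End RegularRepresentation.

(** * Multi-affine functions of the conjugates *)

Section MultiAffine.

Variables (L : fieldType) (K : nmodType) (n : nat) (s : 'I_n -> K -> L).
Hypothesis sD : forall i, {morph s i : x y / x + y}.
Hypothesis s_indep :
  forall c : 'I_n -> L, (forall k, \sum_i c i * s i k = 0) ->
  forall i, c i = 0.

(** Induction on the degree: the difference f(k + h) - f(k) has smaller degree,
    and its coefficients of top degree are combinations of the s_i(h) with the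
    top coefficients of f.  Each variable has degree at most 1, hence no
    division by integers occurs and the argument holds over every field. *)
Lemma multiaffine_eq0 (c : {set 'I_n} -> L) :
    (forall k, \sum_S c S * \prod_(i in S) s i k = 0) ->
  forall S, c S = 0.
Proof.
suff main d : forall c : {set 'I_n} -> L,
    (forall S : {set 'I_n}, (d < #|S|)%N -> c S = 0) ->
    (forall k, \sum_S c S * \prod_(i in S) s i k = 0) ->
  forall S, c S = 0.
  move=> c0; apply: (main n) => // S.
  by rewrite ltnNge (leq_trans (max_card _)) ?card_ord.
elim: d => [|d IHd] {}c cd c0.
  move=> S; have [->|] := eqVneq S set0; last by rewrite -card_gt0 => /cd.
  rewrite -[RHS](c0 0%R) (bigD1 set0) //= big_set0 mulr1 big1 ?addr0 // => T.
  by rewrite -card_gt0 => /cd ->; rewrite mul0r.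
(* D h S is the coefficient at S of f(k + h) - f(k). *)
pose D h (S : {set 'I_n}) :=
  \sum_(T : {set 'I_n} | S \proper T) c T * \prod_(i in T :\: S) s i h.
have D0 h : forall S, D h S = 0.
  apply: IHd => [S ltdS|k].
    rewrite /D big1 // => T /proper_card ltST.
    by rewrite cd ?mul0r // (leq_ltn_trans _ ltST).
  have e : \sum_S c S * \prod_(i in S) s i (k + h)
             - \sum_S c S * \prod_(i in S) s i k = 0 by rewrite !c0 subrr.
  rewrite -[RHS]e -sumrB.
  under eq_bigr do rewrite mulr_suml.
  rewrite (exchange_big_dep xpredT) //=; apply: eq_bigr => T _.
  rewrite -mulrBr.
  have -> : \prod_(i in T) s i (k + h)
    = \sum_(S : {set 'I_n} | S \subset T)
        (\prod_(i in T :\: S) s i h) * \prod_(i in S) s i k.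
    rewrite big_mkcond /=.
    transitivity (\prod_i ((if i \in T then s i k else 0)
                           + (if i \in T then s i h else 1))).
      by apply: eq_bigr => i _; case: ifP => _; rewrite ?sD ?add0r.
    rewrite bigA_distr [RHS]big_mkcond /=; apply: eq_bigr => S _.
    case: ifPn => [sST|/subsetPn[i Si T'i]]; last first.
      by rewrite (bigD1 i) //= Si (negPf T'i) mul0r.
    rewrite [in RHS]mulrC !(big_mkcond (fun i => i \in _)) -big_split /=.
    apply: eq_bigr => i _; rewrite in_setD.
    case: (boolP (i \in S)) => [/(subsetP sST)->|_] /=; rewrite ?mulr1 //.
    by rewrite mul1r.
  rewrite [X in c T * (X - _)](bigD1 T) //= setDv big_set0 mul1r.
  rewrite addrC addrK mulr_sumr.
  by apply: eq_big => S; [rewrite properEneq andbC|rewrite mulrA].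
apply: IHd => // T ltdT; have [/cd //|leTd] := ltnP d.+1 #|T|.
have cardT : #|T| = d.+1 by apply/eqP; rewrite eqn_leq leTd.
have [t Tt] : exists t, t \in T by apply/card_gt0P; rewrite cardT.
(* For S of size d only the sets S U {i} contribute to D h S; the coefficient
   of s_t(h) is then c T. *)
pose S := T :\ t.
have St : t |: S = T by rewrite setD1K.
have cardS : #|S| = d by have := cardsD1 t T; rewrite Tt cardT; case.
have := @s_indep (fun i => if i \in S then 0 else c (i |: S)) _ t.
rewrite in_setD1 eqxx /= St; apply=> k.
rewrite -[RHS](D0 k S) /D.
rewrite (bigID (fun i => i \in S)) /= big1 ?add0r; last first.
  by move=> i ->; rewrite mul0r.
rewrite [RHS](bigID (fun T : {set 'I_n} => #|T| == d.+1)) /=.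
rewrite [X in _ = _ + X]big1 ?addr0; last first.
  move=> U /andP[/proper_card]; rewrite cardS => ltdU neU.
  by rewrite cd ?mul0r // ltn_neqAle eq_sym neU.
pose W := [set i |: S | i in ~: S].
rewrite (eq_bigl (fun U => U \in W)); last first.
  move=> U; apply/andP/imsetP => [[ltSU /eqP cU]|[i]].
    have /card_gt0P[i] : (0 < #|U :\: S|)%N.
      by rewrite cardsD (setIidPr (proper_sub ltSU)) cardS cU subSnn.
    rewrite in_setD => /andP[S'i Ui]; exists i; first by rewrite in_setC.
    apply/esym/eqP; rewrite eqEcard cU cardsU1 S'i cardS leqnn andbT.
    by rewrite subUset sub1set Ui proper_sub.
  rewrite in_setC => S'i ->; rewrite cardsU1 S'i cardS eqxx; split=> //.
  by rewrite properEcard subsetUr cardsU1 S'i add1n leqnn.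
rewrite big_imset /=; last first.
  move=> i j; rewrite !in_setC => S'i S'j e.
  have := setU11 i S; rewrite e in_setU1 => /orP[/eqP //|].
  by rewrite (negPf S'i).
apply: eq_big => [i|i S'i]; first by rewrite in_setC.
rewrite (negPf S'i); congr (_ * _).
have -> : (i |: S) :\: S = [set i].
  by rewrite setDUl setDv setU0; apply/setDidPl; rewrite disjoints1.
by rewrite big_set1.
Qed.

End MultiAffine.

(** * Principal minors and Hamiltonian cycles *)

Section PrincipalMinors.

Variables (L : fieldType) (n : nat).
Implicit Types (a : 'M[L]_n) (S : {set 'I_n}).

(** The Leibniz formula for the principal minor of a on S, kept over the
    permutations of all indices to avoid reindexing S. *)
Definition pminor a S : L :=
  \sum_(s : 'S_n | perm_on S s) (-1) ^+ s * \prod_(i in S) a i (s i).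

(** Expand each factor of the Leibniz formula; S collects the indices where the
    term -d_i a_ij is chosen, and the others must be fixed points. *)
Lemma char_poly_row_scale (d : 'I_n -> L) a :
  char_poly (\matrix_(i, j) (d i * a i j))
    = \sum_(S : {set 'I_n})
        (\prod_(i in S) - d i * pminor a S) *: 'X^(n - #|S|).
Proof.
rewrite /char_poly /determinant.
under eq_bigr => s _.
  rewrite (eq_bigr (fun i => (- (d i * a i (s i)))%:P
             + 'X *+ (i == s i))); last first.
    by move=> i _; rewrite !mxE rmorphN addrC.
  rewrite bigA_distr mulr_sumr.
  over.
rewrite exchange_big /=; apply: eq_bigr => S _.
rewrite /pminor mulr_sumr scaler_suml [RHS]big_mkcond /=.
apply: eq_bigr => s _; case: ifPn => [onS|offS].
  have e1 : \prod_(i | i \notin S) (if i \in S then (- (d i * a i (s i)))%:P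
              else 'X *+ (i == s i)) = 'X^(n - #|S|).
    have <- : #|~: S| = (n - #|S|)%N by rewrite cardsCs setCK card_ord.
    rewrite -prodr_const; apply: eq_big => [i|i S'i]; first by rewrite in_setC.
    rewrite (negPf S'i); case: eqP => // /eqP.
    by rewrite eq_sym => /(subsetP onS); rewrite (negPf S'i).
  have e2 : \prod_(i in S) (if i \in S then (- (d i * a i (s i)))%:P
              else 'X *+ (i == s i))
            = (\prod_(i in S) - d i * \prod_(i in S) a i (s i))%:P.
    rewrite -big_split rmorph_prod /=; apply: eq_bigr => i ->.
    by rewrite mulNr.
  rewrite (bigID (fun i => i \in S)) /= e1 e2.
  rewrite -[in LHS](rmorph_sign (@polyC L)) /=.
  by rewrite !mul_polyC scalerA mulrCA.
have [i si S'i] : exists2 i, s i != i & i \notin S by apply/subsetPn.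
rewrite (bigD1 i) //= (negPf S'i) eq_sym (negPf si).
by rewrite mulr0n mul0r mulr0.
Qed.

Lemma coef_char_poly_row_scale (d : 'I_n -> L) a m : (m <= n)%N ->
  (char_poly (\matrix_(i, j) (d i * a i j)))`_(n - m)
    = (-1) ^+ m * \sum_(S : {set 'I_n}) (if #|S| == m then pminor a S else 0)
                    * \prod_(i in S) d i.
Proof.
move=> le_mn; rewrite char_poly_row_scale coef_sum mulr_sumr.
apply: eq_bigr => S _; rewrite coefZ coefXn.
have leSn : (#|S| <= n)%N by rewrite -[n in leqRHS]card_ord max_card.
have -> : (n - m == n - #|S|)%N = (#|S| == m).
  by rewrite eq_sym; apply/eqP/eqP => [e|->//]; rewrite -(subKn leSn) e subKn.
have [<-|] := eqVneq; last by rewrite mulr0 mul0r mulr0.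
by rewrite mulr1 prodrN -mulrA [X in _ * X]mulrC.
Qed.

(** Take a smallest nonempty S in which every vertex has an arrow to S.  Any
    choice of arrows inside S permutes S, its image being another such set, so
    the arrows inside S are unique.  The minor on S is then a single nonzero
    product, which forces S to be everything. *)
Lemma cyclic_pattern a :
    (0 < n)%N -> (forall i, exists j, a i j != 0) ->
    (forall S, (0 < #|S| < n)%N -> pminor a S = 0) ->
  exists f : 'I_n -> 'I_n,
    (forall i j, (a i j != 0) = (j == f i)) /\
    (forall S, S != set0 -> (forall i, i \in S -> f i \in S) -> S = setT).
Proof.
move=> n_gt0 a_row a_minor.
pose P S := (S != set0) && [forall i in S, exists j in S, a i j != 0].
have PT : P setT.
  apply/andP; split; first by rewrite -card_gt0 cardsT card_ord.
  apply/forall_inP => i _; have [j aij] := a_row i.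
  by apply/exists_inP; exists j.
have [S] := arg_minnP (fun S : {set 'I_n} => #|S|) PT.
move=> /andP[S_n0 /forall_inP S_out] S_min.
pose out f := forall i, i \in S -> (f i \in S) && (a i (f i) != 0).
have [f f_out] : exists f, out f.
  exists (fun i => odflt i [pick j in S | a i j != 0]) => i /S_out.
  case: pickP => [j //|noj] /exists_inP[j Sj aij].
  by have := noj j; rewrite Sj aij.
have outP g : out g -> g @: S = S /\ {in S &, injective g}.
  move=> gS; have gSS : g @: S \subset S.
    by apply/subsetP => _ /imsetP[i Si ->]; case/andP: (gS i Si).
  have leS : (#|S| <= #|g @: S|)%N.
    apply: S_min; apply/andP; split.
      have [i Si] := set0Pn _ S_n0.
      by apply/set0Pn; exists (g i); apply: imset_f.
    apply/forall_inP => _ /imsetP[i Si ->]; have /andP[Sgi _] := gS i Si.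
    apply/exists_inP; exists (g (g i)); first by rewrite imset_f.
    by case/andP: (gS _ Sgi).
  split; first by apply/eqP; rewrite eqEcard gSS.
  by apply/imset_injP; rewrite eqn_leq leq_imset_card.
have [fS f_inj] := outP f f_out.
(* Two arrows from i would give two permutations of S that differ only at i. *)
have f_uniq i j : i \in S -> j \in S -> a i j != 0 -> j = f i.
  move=> Si Sj aij; pose g k := if k == i then j else f k.
  have [|gS _] := outP g.
    by rewrite /g => k Sk; case: eqP => [->|_]; [rewrite Sj|apply: f_out].
  have : f i \in g @: S by rewrite gS; case/andP: (f_out i Si).
  case/imsetP => k Sk; rewrite /g; case: eqP => // ki fik.
  by case: ki; apply/esym/f_inj.
(* The only permutation that contributes to the minor on S. *)
pose h i := if i \in S then f i else i.
have h_inj : injective h.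
  move=> i j; rewrite /h; case: ifPn => Si; case: ifPn => Sj //.
  - exact: f_inj.
  - by move=> e; case/andP: (f_out i Si); rewrite e (negPf Sj).
  - by move=> e; case/andP: (f_out j Sj); rewrite -e (negPf Si).
have minS : pminor a S != 0.
  rewrite /pminor (bigD1 (perm h_inj)) /=; last first.
    by apply/subsetP => i; rewrite inE permE /h; case: ifP => //; rewrite eqxx.
  rewrite [X in _ + X]big1 ?addr0 => [|s /andP[sS nesh]].
    rewrite mulf_neq0 ?signr_eq0 //; apply/prodf_neq0 => i Si.
    by rewrite permE /h Si; case/andP: (f_out i Si).
  have [i Si nei] : exists2 i, i \in S & s i != f i.
    apply/exists_inP; apply: contraNT nesh; rewrite negb_exists_in.
    move/forall_inP => sf; apply/eqP/permP => i; rewrite permE /h.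
    case: ifPn => [/sf|]; first by rewrite negbK => /eqP.
    exact: out_perm.
  rewrite (bigD1 i) //=; have [->|aisi] := eqVneq (a i (s i)) 0.
    by rewrite mul0r mulr0.
  by rewrite (f_uniq i (s i)) ?eqxx ?perm_closed in nei.
have ST : S = setT.
  apply/eqP; rewrite eqEcard subsetT cardsT card_ord leqNgt /=.
  by apply: contraNN minS => ltS; rewrite a_minor ?eqxx // ltS card_gt0 S_n0.
exists f; split=> [i j|S' nzS' fS'].
  apply/idP/eqP => [|->]; first by apply: f_uniq; rewrite ST in_setT.
  by have /f_out/andP[_] : i \in S by rewrite ST in_setT.
apply/eqP; rewrite eqEcard subsetT -ST S_min //.
apply/andP; split=> //; apply/forall_inP => i S'i; apply/exists_inP.
exists (f i); first exact: fS'.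
by have /f_out/andP[] : i \in S by rewrite ST in_setT.
Qed.

End PrincipalMinors.

(** * Reduced characteristic polynomials *)

Lemma char_poly_similar (E : fieldType) p q (Q : 'M[E]_(p, q))
    (R : 'M[E]_q) (D : 'M[E]_p) :
  p = q -> row_full Q -> Q *m R = D *m Q -> char_poly R = char_poly D.
Proof.
move=> epq; case: q / epq Q R => Q R.
rewrite -col_leq_rank -[(_ <= _)%N]/(p <= \rank Q)%N row_leq_rank row_free_unit.
rewrite unitmxE unitfE => nzQ QR.
have := congr1 determinant (_ : map_mx polyC Q *m char_poly_mx R
                                = char_poly_mx D *m map_mx polyC Q).
rewrite !det_mulmx mulrC => e; apply: (mulIf (x := \det (map_mx polyC Q))).
  by rewrite det_map_mx polyC_eq0.
apply: e; rewrite mulmxBr mulmxBl -!map_mxM QR.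
by rewrite mul_mx_scalar mul_scalar_mx.
Qed.

Section BlockDiagonal.

Variables (E : fieldType) (n N : nat) (Y : 'M[E]_n) (R : 'M[E]_N).

(** Here m copies of Y on the diagonal, and m blocks of rows, are built by
    recursion so that [m.+1 * n] unfolds to [n + m * n]. *)
Fixpoint stack m (S : nat -> 'M[E]_(n, N)) : 'M[E]_(m * n, N) :=
  if m is m'.+1 then col_mx (S 0%N) (stack m' (S \o succn)) else 0.

Fixpoint repeat_diag m : 'M[E]_(m * n) :=
  if m is m'.+1 then block_mx Y 0 0 (repeat_diag m') else 0.

Lemma char_poly_repeat_diag m : char_poly (repeat_diag m) = char_poly Y ^+ m.
Proof.
elim: m => [|m IHm] /=; first by rewrite expr0 /char_poly det_mx00.
rewrite exprS -IHm /char_poly (char_block_diag_mx Y (repeat_diag m)).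
exact: det_ublock.
Qed.

Lemma stack_mulmx m S : (forall i, S i *m R = Y *m S i) ->
  stack m S *m R = repeat_diag m *m stack m S.
Proof.
elim: m S => [|m IHm] S SR /=; first by rewrite !mul0mx.
rewrite (mul_col_mx (S 0%N)) (mul_block_col Y) !mul0mx addr0 add0r.
by rewrite SR IHm // => i; apply: SR.
Qed.

Lemma sub_stack m S i : (i < m)%N -> (S i <= stack m S)%MS.
Proof.
elim: m S i => [//|m IHm] S [_|i lt_im] /=.
  by rewrite -(addsmxE (S 0%N)) addsmxSl.
rewrite -(addsmxE (S 0%N)); apply: submx_trans (addsmxSr _ _).
exact: (IHm (S \o succn)).
Qed.

End BlockDiagonal.

(** Unique factorisation; the characteristic may divide n. *)
Lemma monic_exp_inj (E : fieldType) (p q : {poly E}) n :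
  (0 < n)%N -> p \is monic -> q \is monic -> p ^+ n = q ^+ n -> p = q.
Proof.
move=> n_gt0 mp mq e; apply/eqP; rewrite -eqp_monic // /eqp.
by rewrite -(dvdp_pexp2r p q n_gt0) -(dvdp_pexp2r q p n_gt0) e dvdpp.
Qed.

(** Right multiplication by a matrix Y on square matrices acts on each row
    separately as Y, so it is similar to n diagonal copies of Y. *)
Lemma splitting_char_poly (F : fieldType) (A : falgType F) (n : nat)
    (E : fieldType) (f : {rmorphism F -> E}) (psi : {rmorphism A -> 'M[E]_n}) :
    \dim {:A} = (n ^ 2)%N -> splitting f psi ->
  forall x,
    map_poly f (char_poly (rmx (vbasis {:A}) x)) = char_poly (psi x) ^+ n.
Proof.
move=> dimA [psiZ [g hK gK]] x; set b := vbasis _.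
pose h (c : 'rV[E]_(\dim {:A})) := \sum_i c 0 i *: psi b`_i.
pose R := map_mx f (rmx b x).
have hR c : h (c *m R) = h c *m psi x.
  have psib (i : 'I_(\dim {:A})) : psi (b`_i * x) = \sum_j R i j *: psi b`_j.
    rewrite (crdE (vbasisP _) (b`_i * x)) rmorph_sum /=.
    by apply: eq_bigr => j _; rewrite psiZ !mxE.
  rewrite /h mulmx_suml.
  under eq_bigr do rewrite mxE scaler_suml.
  rewrite exchange_big /=; apply: eq_bigr => i _.
  rewrite -scalemxAl -[psi _ *m _](rmorphM psi) psib scaler_sumr.
  by apply: eq_bigr => j _; rewrite scalerA.
have hD c d : h (c + d) = h c + h d.
  by rewrite /h -big_split; apply: eq_bigr => i _; rewrite mxE scalerDl.
have hZ k c : h (k *: c) = k *: h c.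
  by rewrite /h scaler_sumr; apply: eq_bigr => i _; rewrite mxE scalerA.
have h0 : h 0 = 0 by rewrite -[X in h X](scale0r 0) hZ scale0r.
have h_sum (I : finType) (c : I -> 'rV[E]__) : h (\sum_i c i) = \sum_i h (c i).
  by apply: (big_morph h hD h0).
have h_inj : injective h by apply: can_inj hK.
have gE i j : h (g (delta_mx i j)) = delta_mx i j by apply: gK.
(* Row j of S i is the coordinate vector of the matrix unit E_ij. *)
pose S k : 'M[E]_(n, _) :=
  if insub k is Some i then \matrix_(j < n) g (delta_mx i j) else 0.
have SR k : S k *m R = psi x *m S k.
  rewrite /S; case: insubP => [i _ _|_]; last by rewrite mul0mx mulmx0.
  apply/row_matrixP => j; rewrite !row_mul rowK; apply: h_inj.
  rewrite hR gE mulmx_sum_row h_sum [LHS]matrix_sum_delta (bigD1 i) //=.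
  rewrite [X in _ + X]big1 ?addr0 => [|k' nek']; last first.
    apply: big1 => l _; rewrite mxE big1 ?scale0r // => m _.
    by rewrite mxE (negPf nek') mul0r.
  apply: eq_bigr => l _; rewrite rowK hZ gE !mxE (bigD1 j) //= big1.
    by rewrite addr0 !mxE !eqxx mul1r.
  by move=> m nemj; rewrite mxE (negPf nemj) andbF mul0r.
rewrite map_char_poly -/R -(char_poly_repeat_diag (psi x) n).
apply: (char_poly_similar (Q := stack n S)); last exact: stack_mulmx.
  by rewrite dimA mulnn.
rewrite -sub1mx; apply/row_subP => i; set v := row i _.
have -> : v = \sum_k \sum_l h v k l *: g (delta_mx k l).
  apply: h_inj; rewrite [LHS]matrix_sum_delta h_sum; apply: eq_bigr => k _.
  by rewrite h_sum; apply: eq_bigr => l _; rewrite hZ gE.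
apply: summx_sub => k _; apply: summx_sub => l _; apply: scalemx_sub.
apply: submx_trans (sub_stack S (ltn_ord k)).
rewrite /S; case: insubP => [k' _ /val_inj ->|]; last by rewrite ltn_ord.
by rewrite -[X in (X <= _)%MS](rowK (fun l => g (delta_mx k l))) row_sub.
Qed.

(** The n-th power of the characteristic polynomial is rational over F and does
    not depend on the splitting; extraction of monic n-th roots is unique and
    hence compatible with the Galois action. *)
Lemma red_char_polyE (F : fieldType) (A : falgType F) (n : nat)
    (L : splittingFieldType F) (phi : {rmorphism A -> 'M[L]_n}) :
    \dim {:A} = (n ^ 2)%N -> galois 1 {:L} -> splitting (in_alg L) phi ->
  forall x, map_poly (in_alg L) (red_char_poly n x) = char_poly (phi x).
Proof.
move=> dimA galL split_phi x.
have n_gt0 : (0 < n)%N by rewrite -(@ltn_exp2r 0 n 2) // -dimA adim_gt0.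
pose C := char_poly (rmx (vbasis {:A}) x).
have uniqC (E : fieldType) (f : {rmorphism F -> E})
    (psi : {rmorphism A -> 'M[E]_n}) (p : {poly F}) :
    splitting f psi -> map_poly f p = char_poly (psi x) ->
  p \is monic /\ p ^+ n = C.
  move=> split_psi ep; split.
    by rewrite -(map_monic f) ep char_poly_monic.
  apply: (map_poly_inj f); rewrite rmorphXn /= ep.
  by rewrite -(splitting_char_poly dimA split_psi).
have [p ep] : exists p, map_poly (in_alg L) p = char_poly (phi x).
  suff /polyOver1P[p ->] : char_poly (phi x) \is a polyOver 1%VS by exists p.
  apply/polyOverP => i; rewrite -(galois_fixedField galL).
  apply/fixedFieldP; rewrite ?memvf // => g galg.
  rewrite -[in RHS](_ : map_poly g (char_poly (phi x)) = char_poly (phi x)).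
    by rewrite coef_map.
  apply: (monic_exp_inj n_gt0); rewrite ?map_monic ?char_poly_monic //.
  rewrite -rmorphXn /= -(splitting_char_poly dimA split_phi) -map_poly_comp.
  by apply: eq_map_poly => k /=; rewrite linearZ /= rmorph1.
suff -> : red_char_poly n x = p by [].
have [E [f [psi [split_psi eq]]]] : is_red_char_poly n x (red_char_poly n x).
  by apply: classical_sets.xgetPex; exists p, L, (in_alg L), phi.
have [mp pC] := uniqC _ _ _ _ split_phi ep.
have [mq qC] := uniqC _ _ _ _ split_psi eq.
by apply: (monic_exp_inj n_gt0) => //; rewrite qC pC.
Qed.

(** * A splitting that diagonalises K *)

Section LagrangeFactor.

Variables (L : fieldType) (n : nat) (r : 'I_n -> L).
Hypothesis r_inj : injective r.

(** The numerators of the Lagrange interpolation polynomials at the r_i; on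
    a diagonalisable operator they project to the eigenspaces, up to scalars. *)
Definition lagr i : {poly L} := \prod_(j | j != i) ('X - (r j)%:P).

Lemma lagr_mul i : lagr i * ('X - (r i)%:P) = \prod_j ('X - (r j)%:P).
Proof. by rewrite [RHS](bigD1 i) //= mulrC. Qed.

Lemma lagr_monic i : lagr i \is monic.
Proof. exact: monic_prod_XsubC. Qed.

Lemma size_lagr i : size (lagr i) = n.
Proof.
have -> : lagr i = \prod_(j <- enum (predC1 i)) ('X - (r j)%:P).
  by rewrite big_enum.
rewrite size_prod_XsubC -cardE.
by rewrite cardC1 card_ord prednK // (leq_ltn_trans _ (ltn_ord i)).
Qed.

Lemma horner_lagr i j : ((lagr i).[r j] == 0) = (j != i).
Proof.
rewrite horner_prod; apply/eqP/idP => [/eqP|neji].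
  apply: contraL => /eqP->; apply/prodf_neq0 => k neki.
  by rewrite !hornerE subr_eq0 (inj_eq r_inj) eq_sym.
by rewrite (bigD1 j) //= !hornerE subrr mul0r.
Qed.

Lemma coef_lagr_neq0 i : exists s : 'I_n, (lagr i)`_s != 0.
Proof.
have lt_n : (n.-1 < n)%N by rewrite prednK // (leq_ltn_trans _ (ltn_ord i)).
exists (Ordinal lt_n) => /=.
have /monicP := lagr_monic i.
by rewrite lead_coefE size_lagr => ->; apply: oner_neq0.
Qed.

End LagrangeFactor.

Lemma row_horner_mx (L : fieldType) N (v : 'rV[L]_N.+1) (g : 'M[L]_N.+1)
    (a : L) (p : {poly L}) :
  v *m g = a *: v -> v *m horner_mx g p = p.[a] *: v.
Proof.
move=> vg; elim/poly_ind: p => [|p c IHp].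
  by rewrite rmorph0 mulmx0 horner0 scale0r.
rewrite rmorphD rmorphM /= horner_mx_X horner_mx_C mulmxDr mulmxA IHp.
by rewrite -scalemxAl vg mul_mx_scalar !hornerE scalerDl scalerA.
Qed.

Lemma horner_mx_sum (L : fieldType) N (g : 'M[L]_N.+1) (p : {poly L}) :
  horner_mx g p = \sum_(s < size p) p`_s *: g ^+ s.
Proof.
rewrite -{1}[p]coefK poly_def linear_sum /=; apply: eq_bigr => s _.
by rewrite linearZ rmorphXn /= horner_mx_X.
Qed.

(** The scalar extension of A is realised as the space of row vectors over L,
    with K acting on the left and on the right.  The module V that defines the
    splitting is the eigenspace of the left multiplication by theta for the
    eigenvalue r_i0; A acts on it by right multiplications, and it has a basis
    of eigenvectors for the right multiplication by theta. *)
Section Splitting.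

Variables (F : fieldType) (A : falgType F) (L : fieldType).
Variables (f : {rmorphism F -> L}) (N n : nat) (b : N.+1.-tuple A).
Variables (theta : A) (mu : {poly F}) (r : 'I_n -> L) (i0 : 'I_n).
Hypothesis basis_b : basis_of {:A} b.
Hypothesis dimA : N.+1 = (n * n)%N.
Hypothesis ZA : 'Z({:A})%VS = 1%VS.
Hypothesis simpA : simple_alg A.
Hypothesis r_inj : injective r.
Hypothesis mu_r : map_poly f mu = \prod_i ('X - (r i)%:P).
Hypothesis mu_theta : (map_poly (in_alg A) mu).[theta] = 0.
Hypothesis theta_indep : lin_indep (fun s : 'I_n => theta ^+ s).

Local Notation rmxL x := (map_mx f (rmx b x)).
Local Notation lmxL x := (map_mx f (lmx b x)).
Local Notation l := (lagr r).

Lemma horner_rmx p :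
  horner_mx (rmxL theta) p = \sum_(s < size p) p`_s *: rmxL (theta ^+ s).
Proof.
rewrite horner_mx_sum; apply: eq_bigr => s _; congr (_ *: _).
elim: {s}(nat_of_ord s) => [|s IHs]; first by rewrite !expr0 rmx1 // map_mx1.
by rewrite !exprS IHs rmxM // map_mxM.
Qed.

Lemma horner_lmx p :
  horner_mx (lmxL theta) p = \sum_(s < size p) p`_s *: lmxL (theta ^+ s).
Proof.
rewrite horner_mx_sum; apply: eq_bigr => s _; congr (_ *: _).
elim: {s}(nat_of_ord s) => [|s IHs]; first by rewrite !expr0 lmx1 // map_mx1.
by rewrite exprS IHs exprSr lmxM // map_mxM.
Qed.

Lemma mu_sum0 : \sum_(s < size mu) mu`_s *: theta ^+ s = 0.
Proof.
rewrite -[RHS]mu_theta horner_coef size_map_poly; apply: eq_bigr => s _.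
by rewrite coef_map /= mulr_algl.
Qed.

Lemma horner_rmx_mu : horner_mx (rmxL theta) (map_poly f mu) = 0.
Proof.
rewrite horner_rmx size_map_poly.
under eq_bigr do rewrite coef_map -map_mxZ -linearZ.
by rewrite -raddf_sum -linear_sum mu_sum0 !raddf0.
Qed.

Lemma horner_lmx_mu : horner_mx (lmxL theta) (map_poly f mu) = 0.
Proof.
rewrite horner_lmx size_map_poly.
under eq_bigr do rewrite coef_map -map_mxZ -linearZ.
by rewrite -raddf_sum -linear_sum mu_sum0 !raddf0.
Qed.

Lemma lagr_eigen (g : 'M[L]_N.+1) i : horner_mx g (map_poly f mu) = 0 ->
  horner_mx g (l i) *m g = r i *: horner_mx g (l i).
Proof.
rewrite mu_r -(lagr_mul r i) rmorphM rmorphB /= horner_mx_X horner_mx_C.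
move/eqP; rewrite mulrBr subr_eq0 -[_ * _%:M]/(_ *m _%:M) mul_mx_scalar.
by move/eqP.
Qed.

(** The scalar extension of A is a prime ring: if v x w = 0 for all x then v = 0
    or w = 0.  Here v is the i-th Lagrange polynomial in theta. *)
Lemma lagr_lmx_mul_rmx_eq0 i s (Y : 'I_s -> A) (c : 'I_s -> L) : lin_indep Y ->
  horner_mx (lmxL theta) (l i) *m (\sum_k c k *: rmxL (Y k)) = 0 ->
  forall k, c k = 0.
Proof.
move=> indY; rewrite horner_lmx size_lagr mulmx_suml => e0 k.
have ind := lin_indep_map (f := f)
  (lmx_rmx_indep basis_b ZA simpA theta_indep indY).
have [t nzt] := coef_lagr_neq0 r i.
apply/eqP.
have sum0 : \sum_(tk : 'I_n * 'I_s) ((l i)`_(tk.1) * c tk.2) *: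
    map_mx f (lmx b (theta ^+ tk.1) *m rmx b (Y tk.2)) = 0.
  rewrite -[RHS]e0; transitivity (\sum_(t < n) \sum_(k < s)
      ((l i)`_t * c k) *: map_mx f (lmx b (theta ^+ t) *m rmx b (Y k))).
    by rewrite pair_bigA.
  apply: eq_bigr => u _; rewrite mulmx_sumr; apply: eq_bigr => w _.
  by rewrite -scalemxAl -scalemxAr scalerA map_mxM.
have /eqP := ind _ sum0 (t, k).
by rewrite mulf_eq0 (negPf nzt).
Qed.

(** The product of the two Lagrange operators is nonzero and its rows are common
    eigenvectors. *)
Lemma eigenvectors i : exists B : 'M[L]_(n, N.+1),
  [/\ row_free B, (B <= eigenspace (lmxL theta) (r i))%MS
    & B *m rmxL theta = diag_mx (\row_j r j) *m B].
Proof.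
have ev j : exists v : 'rV[L]_N.+1, [&& v != 0,
    (v <= eigenspace (lmxL theta) (r i))%MS & v *m rmxL theta == r j *: v].
  pose U := horner_mx (lmxL theta) (l i) *m horner_mx (rmxL theta) (l j).
  have nzU : U != 0.
    apply/eqP; rewrite /U horner_rmx size_lagr => U0.
    have [s /eqP[]] := coef_lagr_neq0 r j.
    exact: (lagr_lmx_mul_rmx_eq0 theta_indep U0).
  exists (nz_row U); rewrite nz_row_eq0 nzU /=; apply/andP; split.
    apply: submx_trans (nz_row_sub U) _; apply/eigenspaceP.
    have cLR : comm_mx (rmxL theta) (lmxL theta).
      by rewrite /comm_mx -!map_mxM lmx_rmxC.
    rewrite /U -mulmxA (comm_horner_mx _ cLR) mulmxA.
    by rewrite lagr_eigen ?horner_lmx_mu // scalemxAl.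
  have /submxP[D ->] := nz_row_sub U.
  by rewrite -!mulmxA lagr_eigen ?horner_rmx_mu // -!scalemxAr.
have [v /(_ _)/and3P-/all_and3[nzv Lv Rv]] := fin_all_exists ev.
pose B := \matrix_j v j; exists B; split.
- apply: inj_row_free => c cB0; apply/rowP => k; rewrite mxE.
  have := congr1 (mulmx^~ (horner_mx (rmxL theta) (l k))) cB0.
  rewrite /= mul0mx [c *m B]mulmx_sum_row mulmx_suml (bigD1 k) //=.
  rewrite big1 => [|j nejk].
    rewrite addr0 -scalemxAl rowK (row_horner_mx _ (eqP (Rv k))) scalerA.
    move/eqP; rewrite scaler_eq0 (negPf (nzv k)) orbF mulf_eq0.
    by rewrite horner_lagr // eqxx orbF => /eqP.
  rewrite -scalemxAl rowK (row_horner_mx _ (eqP (Rv j))).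
  have /eqP -> : (l k).[r j] == 0 by rewrite horner_lagr.
  by rewrite scale0r scaler0.
- by apply/row_subP => j; rewrite rowK.
- apply/row_matrixP => j; rewrite !row_mul rowK (eqP (Rv j)).
  by rewrite row_diag_mx mxE -scalemxAl -rowE rowK.
Qed.

(** Each of the n eigenspaces has rank at least n by [eigenvectors], and their
    sum is direct in a space of dimension n^2. *)
Lemma rank_eigenspace i : \rank (eigenspace (lmxL theta) (r i)) = n.
Proof.
have le_n j : (n <= \rank (eigenspace (lmxL theta) (r j)))%N.
  have [B [/eqP rB sB _]] := eigenvectors j.
  by apply: leq_trans (mxrankS sB); rewrite rB.
have /mxdirectP/= dx : mxdirect (\sum_i eigenspace (lmxL theta) (r i))%MS.
  by apply: mxdirect_sum_eigenspace => j k _ _; apply: r_inj.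
have := rank_leq_col (\sum_i (eigenspace (lmxL theta) (r i)))%MS.
rewrite dx => /leq_trans/(_ (eq_leq dimA)) le_nn.
apply/eqP; rewrite eqn_leq le_n andbT -(leq_add2r (n.-1 * n)).
have n_gt0 : (0 < n)%N by apply: leq_ltn_trans (ltn_ord i0).
rewrite -mulSn prednK //; apply: leq_trans le_nn.
rewrite (bigD1 i) //= leq_add2l.
have -> : (n.-1 * n = \sum_(j < n | j != i) n)%N.
  by rewrite sum_nat_const cardC1 card_ord.
exact: leq_sum.
Qed.

(** The matrix of the right multiplication by x in the basis B of eigenvectors.
    It is faithful even after extension of scalars: an element that kills V is
    killed by the left Lagrange operator, whose rows lie in V. *)
Lemma exists_diag_splitting_aux : exists phi : {rmorphism A -> 'M[L]_n},
  [/\ forall c x, phi (c *: x) = f c *: phi x,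
      phi theta = diag_mx (\row_j r j)
    & lin_indep (fun k : 'I_N.+1 => phi b`_k)].
Proof.
have [B [freeB sB thetaB]] := eigenvectors i0.
have VB : (eigenspace (lmxL theta) (r i0) <= B)%MS.
  by rewrite -(geq_leqif (mxrank_leqif_sup sB)) rank_eigenspace (eqP freeB).
pose phi x := B *m rmxL x *m pinvmx B.
have phiB x : phi x *m B = B *m rmxL x.
  rewrite /phi mulmxKpV //; apply: submx_trans VB; apply/eigenspaceP.
  rewrite -mulmxA -map_mxM -lmx_rmxC // map_mxM mulmxA.
  by rewrite (eigenspaceP sB) -scalemxAl.
have phiP x M : M *m B = B *m rmxL x -> phi x = M.
  by move=> e; apply: (row_free_inj freeB); rewrite /= phiB.
have phiM : monoid_morphism phi.
  split=> [|x y]; apply: phiP; last first.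
    by rewrite -mulmxA phiB mulmxA phiB -mulmxA -map_mxM -rmxM.
  by rewrite rmx1 // map_mx1 mulmx1 -[1 *m B]/(1%:M *m B) mul1mx.
have phiA : zmod_morphism phi.
  by move=> x y; rewrite /phi linearB map_mxB mulmxBr mulmxBl.
pose phi1 := HB.pack_for {rmorphism A -> 'M[L]_n} phi
  (GRing.isZmodMorphism.Build _ _ phi phiA)
  (GRing.isMonoidMorphism.Build _ _ phi phiM).
exists phi1; split=> [c x||].
- by rewrite /= /phi linearZ /= map_mxZ -scalemxAr -scalemxAl.
- by apply: phiP; rewrite -thetaB.
move=> c c0; have indb : lin_indep (fun k : 'I_N.+1 => b`_k).
  by move=> d; apply/freeP: d; apply: basis_free basis_b.
apply: (lagr_lmx_mul_rmx_eq0 (i := i0) (Y := fun k : 'I_N.+1 => b`_k)) => //.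
have /submxP[D ->] : (horner_mx (lmxL theta) (l i0) <= B)%MS.
  apply: submx_trans VB; apply/eigenspaceP.
  by rewrite lagr_eigen // horner_lmx_mu.
rewrite -mulmxA; apply/eqP; rewrite [X in D *m X](_ : _ = 0) ?mulmx0 //.
rewrite -[RHS](mul0mx _ B) -c0 mulmx_sumr mulmx_suml.
by apply: eq_bigr => k _; rewrite -scalemxAr -scalemxAl phiB.
Qed.

End Splitting.

Lemma lin_indep_bijective (L : fieldType) N n (X : 'I_N -> 'M[L]_n) :
    N = (n * n)%N -> lin_indep X ->
  bijective (fun c : 'rV[L]_N => \sum_i c 0 i *: X i).
Proof.
move=> dimN indX; pose T := \matrix_i mxvec (X i).
have hT (c : 'rV[L]_N) : c *m T = mxvec (\sum_i c 0 i *: X i).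
  rewrite mulmx_sum_row linear_sum; apply: eq_bigr => i _.
  by rewrite rowK linearZ.
have freeT : row_free T.
  apply: inj_row_free => c; rewrite hT => /(canRL mxvecK).
  rewrite linear0 => c0.
  by apply/rowP => i; rewrite mxE; apply: indX c0 i.
have fullT : row_full T by rewrite /row_full (eqP freeT) dimN.
exists (fun M => mxvec M *m pinvmx T) => [c|M].
  by rewrite -hT mulmxKp.
by apply: (can_inj mxvecK); rewrite -hT mulmxKpV // submx_full.
Qed.

Lemma exists_diag_splitting (F : fieldType) (A : falgType F) (L : fieldType)
    (f : {rmorphism F -> L}) n (theta : A) (mu : {poly F}) (r : 'I_n -> L) :
    (0 < n)%N -> central_simple A n -> injective r ->
    map_poly f mu = \prod_i ('X - (r i)%:P) ->
    (map_poly (in_alg A) mu).[theta] = 0 ->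
    lin_indep (fun s : 'I_n => theta ^+ s) ->
  exists phi : {rmorphism A -> 'M[L]_n},
    [/\ splitting f phi, phi theta = diag_mx (\row_j r j)
      & lin_indep (fun k : 'I_(\dim {:A}) => phi (vbasis {:A})`_k)].
Proof.
move=> n_gt0 [ZA simpA]; rewrite -mulnn => dimA r_inj mu_r mu_theta th_ind.
have [phi [phiZ phi_th phi_ind]] : exists phi : {rmorphism A -> 'M[L]_n},
  [/\ forall c x, phi (c *: x) = f c *: phi x,
      phi theta = diag_mx (\row_j r j)
    & lin_indep (fun k : 'I_(\dim {:A}) => phi (vbasis {:A})`_k)].
  move: (vbasis {:A}) (vbasisP {:A}) dimA; move: (\dim {:A}) => N.
  case: N => [|N] b basis_b dimA.
    by have := muln_gt0 n n; rewrite -dimA n_gt0.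
  exact: (exists_diag_splitting_aux (Ordinal n_gt0) basis_b dimA ZA simpA r_inj
            mu_r mu_theta th_ind).
exists phi; split=> //; split=> //.
exact: (lin_indep_bijective dimA phi_ind).
Qed.

(** * Galois invariance of the support of a matrix *)

Section Invariance.

Variables (F : fieldType) (A : falgType F) (L : fieldType) (n : nat).
Variables (f : {rmorphism F -> L}) (r : 'I_n -> L).
Variables (theta : A) (phi : {rmorphism A -> 'M[L]_n}).
Hypothesis r_inj : injective r.
Hypothesis phiZ : forall c x, phi (c *: x) = f c *: phi x.
Hypothesis phi_theta : phi theta = diag_mx (\row_j r j).
Hypothesis phi_indep :
  lin_indep (fun k : 'I_(\dim {:A}) => phi (vbasis {:A})`_k).

Local Notation l := (lagr r).
Local Notation b := (vbasis {:A}).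

Lemma diag_splitting_crd x :
  phi x = \sum_k (map_mx f (crd b x)) 0 k *: phi b`_k.
Proof.
rewrite {1}(crdE (vbasisP _) x) rmorph_sum; apply: eq_bigr => k _.
by rewrite /= phiZ [in RHS]mxE.
Qed.

Lemma diag_splitting_inj : injective phi.
Proof.
apply: raddf_inj => x x0; have := diag_splitting_crd x; rewrite x0 => /esym.
move/phi_indep => {}x0.
apply: (crd_inj (vbasisP {:A})); apply/rowP => k.
by have /eqP := x0 k; rewrite mxE fmorph_eq0 => /eqP ->; rewrite linear0 mxE.
Qed.

Lemma splitting_exp_theta s : phi (theta ^+ s) = diag_mx (\row_j r j ^+ s).
Proof.
rewrite rmorphXn phi_theta; elim: s => [|s IHs].
  apply/matrixP => i j; rewrite expr0 -[1]/(1%:M) !mxE expr0.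
  by case: eqP.
rewrite exprS IHs -[LHS]/(_ *m _) mulmx_diag; congr diag_mx.
by apply/rowP => j; rewrite !mxE exprS.
Qed.

(** The coordinates of l_i(theta) x l_j(theta): the component of x on which K
    acts on the left through its i-th conjugate and on the right through its
    j-th one.  It is written with rational vectors, so that the Galois action on
    it can be computed. *)
Definition component x i j : 'rV[L]_(\dim {:A}) :=
  \sum_(s < n) \sum_(t < n)
    ((l i)`_s * (l j)`_t) *: map_mx f (crd b (theta ^+ s * x * theta ^+ t)).

Lemma componentE x i j : \sum_k component x i j 0 k *: phi b`_k
  = ((l i).[r i] * phi x i j * (l j).[r j]) *: delta_mx i j.
Proof.
transitivity (\sum_(s < n) \sum_(t < n)
    ((l i)`_s * (l j)`_t) *: phi (theta ^+ s * x * theta ^+ t)).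
  under eq_bigr do rewrite summxE scaler_suml.
  rewrite exchange_big; apply: eq_bigr => s _ /=.
  under eq_bigr do rewrite summxE scaler_suml.
  rewrite exchange_big; apply: eq_bigr => t _ /=.
  rewrite diag_splitting_crd scaler_sumr; apply: eq_bigr => k _.
  by rewrite mxE scalerA.
apply/matrixP => i1 j1; rewrite !mxE summxE.
transitivity ((l i).[r i1] * phi x i1 j1 * (l j).[r j1]).
  rewrite (@horner_coef_wide _ n) ?size_lagr // mulr_suml.
  rewrite [in RHS](@horner_coef_wide _ n (l j)) ?size_lagr //.
  rewrite mulr_suml; apply: eq_bigr => s _; rewrite summxE mulr_sumr.
  apply: eq_bigr => t _; rewrite mxE !rmorphM /= !splitting_exp_theta.
  rewrite -[_ * diag_mx _]/(_ *m _) -[diag_mx _ * _]/(_ *m _) mul_mx_diag.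
  by rewrite mxE mul_diag_mx !mxE; ring.
have [->|nei] := eqVneq i1 i; last first.
  have /eqP -> : (l i).[r i1] == 0 by rewrite horner_lagr.
  by rewrite !mul0r mulr0.
have [->|nej] := eqVneq j1 j; first by rewrite mulr1.
have /eqP -> : (l j).[r j1] == 0 by rewrite horner_lagr.
by rewrite !mulr0.
Qed.

(** A combination of the phi(b_k) over L vanishes only if its coefficients do,
    so the (i, j) entry detects the whole component. *)
Lemma component_eq0 x i j : (component x i j == 0) = (phi x i j == 0).
Proof.
have eij : ((l i).[r i] * phi x i j * (l j).[r j] == 0) = (phi x i j == 0).
  by rewrite !mulf_eq0 !horner_lagr // !eqxx /= orbF.
rewrite -eij; apply/eqP/eqP => [c0|e0].
  have := componentE x i j; rewrite c0 big1 => [/esym/matrixP/(_ i j)|k _].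
    by rewrite !mxE !eqxx mulr1.
  by rewrite mxE scale0r.
have := componentE x i j; rewrite e0 scale0r => /phi_indep c0.
by apply/rowP => k; rewrite mxE.
Qed.

(** g carries the component of x at (i, j) to the one at (i', j'), for the
    coordinates of theta^s x theta^t lie in F. *)
Lemma splitting_support_invariant (g : {rmorphism L -> L}) x i j i' j' :
    (forall c, g (f c) = f c) ->
    map_poly g (\prod_i ('X - (r i)%:P)) = \prod_i ('X - (r i)%:P) ->
    g (r i) = r i' -> g (r j) = r j' ->
  (phi x i j == 0) = (phi x i' j' == 0).
Proof.
move=> gf gr gi gj.
have g_lagr k k' : g (r k) = r k' -> map_poly g (l k) = l k'.
  move=> gk; apply: (mulIf (negbT (polyXsubC_eq0 (r k')))).
  rewrite lagr_mul -gr -(lagr_mul r k) rmorphM /=; congr (_ * _).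
  by rewrite rmorphB /= map_polyX map_polyC /= gk.
have -> := esym (component_eq0 x i j); rewrite -component_eq0 -(map_mx_eq0 g).
congr (_ == 0); rewrite /component raddf_sum; apply: eq_bigr => s _.
rewrite raddf_sum; apply: eq_bigr => t _; rewrite /= map_mxZ rmorphM.
rewrite -(g_lagr i i') // -(g_lagr j j') // !coef_map; congr (_ *: _).
by apply/rowP => k; rewrite !mxE gf.
Qed.

End Invariance.

(** * Conjugates of a generator of K *)

(** Conjugates are indexed by Galois automorphisms h_i and not by roots, so
    that every element of the field, and not only xi, has its i-th conjugate. *)
Lemma primitive_conjugates (F : fieldType) (L : splittingFieldType F)
    (E : {subfield L}) n :
    separable 1 E -> galois 1 {:L} -> \dim E = n ->
  exists xi : L, exists h : 'I_n -> gal_of {:L},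
    [/\ (E : {vspace L}) = <<1; xi>>%VS, injective (fun i => h i xi)
      & minPoly 1 xi = \prod_i ('X - (h i xi)%:P)].
Proof.
move=> sepE galL dimE; pose xi := separable_generator 1 E.
have Exi : (E : {vspace L}) = <<1; xi>>%VS.
  exact: eq_adjoin_separable_generator sepE (sub1v E).
have [s [_ uniq_s min_s]] := galois_factors (sub1v _) galL xi (memvf xi).
have size_s : size s = n.
  have := size_minPoly 1%AS xi; rewrite min_s size_prod_XsubC size_map.
  by case=> ->; rewrite -dimE Exi dim_Fadjoin dimv1 muln1.
exists xi, (fun i => nth 1%g s i); split=> // [i j|].
  move/eqP; rewrite -!(nth_map 1%g 0 (fun x : gal_of _ => x xi)) ?size_s //.
  by rewrite nth_uniq ?size_map ?size_s // => /eqP/val_inj.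
by rewrite min_s big_map (big_nth 1%g) size_s big_mkord.
Qed.

Section SubfieldSplitting.

Variables (F : fieldType) (A : falgType F) (n : nat) (K : {aspace A}).
Variables (L : splittingFieldType F) (iota : 'AHom(subvs_of K, L)).
Hypothesis subK : is_subfield K.

(** The unit of [subvs_of K] is the identity of K, which is 1 only because K
    is a subfield; this is what the case of exponent 0 uses. *)
Lemma vsval_exp (k : subvs_of K) s : vsval (k ^+ s) = vsval k ^+ s.
Proof.
elim: s => [|s IHs]; last by rewrite !exprS /= -IHs.
by case: subK => K1 _ _; apply/eqP; rewrite !expr0 /= algid_eq1.
Qed.

Lemma vsval_horner (p : {poly F}) (k : subvs_of K) :
  vsval (map_poly (in_alg _) p).[k] = (map_poly (in_alg A) p).[vsval k].
Proof.
rewrite !horner_coef !size_map_poly linear_sum; apply: eq_bigr => s _.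
rewrite !coef_map /= mulr_algl -scalerAl algidl; last exact: valP.
by rewrite vsval_exp.
Qed.

Lemma subfield_ahom_inj : injective iota.
Proof.
apply: raddf_inj => k iota_k; apply: contraTeq (oner_neq0 L) => nzk.
rewrite negbK; case: subK => _ _ K_unit.
have /K_unit[] // : vsval k \in K by apply: valP.
move=> Uk _; rewrite -(rmorph1 iota) -(mulVr (vsval_unitr Uk)) rmorphM /=.
by rewrite iota_k mulr0.
Qed.

Lemma ahom_horner (p : {poly F}) (k : subvs_of K) :
  iota (map_poly (in_alg _) p).[k] = (map_poly (in_alg L) p).[iota k].
Proof.
rewrite -horner_map -map_poly_comp; congr (_.[_]).
by apply: eq_map_poly => c /=; rewrite linearZ /= rmorph1.
Qed.

(** Every k in K is a polynomial in the element theta with iota theta = xi, so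
    diagonalising theta is enough. *)
Lemma subfield_diag_splitting (xi : L) (h : 'I_n -> gal_of {:L}) :
    (0 < n)%N -> central_simple A n -> \dim K = n ->
    limg iota = <<1; xi>>%VS -> injective (fun i => h i xi) ->
    minPoly 1 xi = \prod_i ('X - (h i xi)%:P) ->
  exists phi : {rmorphism A -> 'M[L]_n},
    [/\ splitting (in_alg L) phi,
        forall k : subvs_of K, phi (vsval k) = diag_mx (\row_i h i (iota k))
      & lin_indep (fun k : 'I_(\dim {:A}) => phi (vbasis {:A})`_k)].
Proof.
move=> n_gt0 csA dimK Kxi h_inj min_xi.
have /memv_imgP[th _ xiE] : xi \in limg iota by rewrite Kxi memv_adjoin.
have /polyOver1P[mu muE] := minPolyOver 1%AS xi.
have deg_xi : adjoin_degree 1 xi = n.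
  have := size_minPoly 1%AS xi; rewrite min_xi size_prod_XsubC.
  by rewrite -[index_enum _]enumT size_enum_ord => -[].
have mu_th0 : (map_poly (in_alg _) mu).[th] = 0.
  apply: subfield_ahom_inj; rewrite ahom_horner -xiE -muE minPolyxx.
  by rewrite raddf0.
have [|||phi [split_phi phi_th phi_ind]] :=
  @exists_diag_splitting F A L (in_alg L) n (vsval th) mu _ n_gt0 csA h_inj.
- by rewrite -muE.
- by rewrite -vsval_horner mu_th0.
- move=> c c0 s.
  (* A relation between powers of theta is a polynomial of degree less than n
     with root xi. *)
  pose p := \poly_(s < n) (if insub s is Some s' then c s' else 0).
  have p_c (t : 'I_n) : p`_t = c t.
    by rewrite coef_poly ltn_ord insubT // => lt_t; congr c; apply: val_inj.
  have p0 : map_poly (in_alg L) p = 0.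
    apply/eqP; rewrite -(@root_small_adjoin_poly _ _ 1%AS xi).
    - rewrite xiE rootE -ahom_horner.
      rewrite (_ : (map_poly (in_alg _) p).[th] = 0) ?raddf0 //.
      apply: val_inj; rewrite /= vsval_horner.
      rewrite (@horner_coef_wide _ n) ?size_map_poly ?size_poly //= -[RHS]c0.
      by apply: eq_bigr => t _; rewrite coef_map /= p_c mulr_algl.
    - by apply/polyOver1P; exists p.
    by rewrite size_map_poly deg_xi size_poly.
  by move/eqP: p0; rewrite map_poly_eq0 -p_c => /eqP ->; rewrite coef0.
exists phi; split=> // k.
have /Fadjoin1_polyP[p kp] : iota k \in <<1; xi>>%VS.
  by rewrite -Kxi memv_img // memvf.
have -> : k = (map_poly (in_alg _) p).[th].
  by apply: subfield_ahom_inj; rewrite ahom_horner -xiE.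
have [phiZ _] := split_phi.
rewrite vsval_horner ahom_horner -xiE horner_coef size_map_poly rmorph_sum.
apply/matrixP => i j; rewrite summxE !mxE -horner_map -map_poly_comp.
rewrite (eq_map_poly (g := in_alg L)); last first.
  by move=> c /=; rewrite linearZ /= rmorph1.
rewrite horner_coef size_map_poly -sumrMnl; apply: eq_bigr => s _.
rewrite !coef_map /= mulr_algl phiZ (splitting_exp_theta phi_th) !mxE.
by rewrite mulrnAr.
Qed.

End SubfieldSplitting.

(** * The Kummer condition *)

Section KummerLine.

Variables (F : fieldType) (A : falgType F) (n : nat) (K : {aspace A}).
Variables (L : splittingFieldType F) (iota : 'AHom(subvs_of K, L)).
Variables (xi : L) (h : 'I_n -> gal_of {:L}) (phi : {rmorphism A -> 'M[L]_n}).
Hypothesis n_gt0 : (0 < n)%N.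
Hypothesis csA : central_simple A n.
Hypothesis galL : galois 1 {:L}.
Hypothesis iota_xi : limg iota = <<1; xi>>%VS.
Hypothesis h_inj : injective (fun i => h i xi).
Hypothesis min_xi : minPoly 1 xi = \prod_i ('X - (h i xi)%:P).
Hypothesis split_phi : splitting (in_alg L) phi.
Hypothesis phi_diag :
  forall k : subvs_of K, phi (vsval k) = diag_mx (\row_i h i (iota k)).
Hypothesis phi_indep :
  lin_indep (fun k : 'I_(\dim {:A}) => phi (vbasis {:A})`_k).

Local Notation r i := (h i xi).

Lemma gal_fix_alg (g : gal_of {:L}) (c : F) : g (in_alg L c) = in_alg L c.
Proof. by rewrite /= linearZ /= rmorph1. Qed.

Lemma gal_fix_min (g : gal_of {:L}) :
  map_poly g (\prod_i ('X - (r i)%:P)) = \prod_i ('X - (r i)%:P).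
Proof.
rewrite -min_xi; have /polyOver1P[mu ->] := minPolyOver 1%AS xi.
by rewrite -map_poly_comp; apply: eq_map_poly => c; apply: gal_fix_alg.
Qed.

Lemma gal_conjugate (g : gal_of {:L}) i : exists j, g (r i) = r j.
Proof.
have : root (\prod_i ('X - (r i)%:P)) (g (r i)).
  rewrite -(gal_fix_min g) fmorph_root rootE horner_prod (bigD1 i) //=.
  by rewrite !hornerE subrr mul0r.
rewrite rootE horner_prod => /prodf_eq0[j _].
by rewrite !hornerE subr_eq0 => /eqP gi; exists j.
Qed.

Lemma gal_eq_generator (x y : gal_of {:L}) k :
  x xi = y xi -> x (iota k) = y (iota k).
Proof.
move=> xy; have /Fadjoin1_polyP[p ->] : iota k \in <<1; xi>>%VS.
  by rewrite -iota_xi memv_img // memvf.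
rewrite -!horner_map /= xy -!map_poly_comp; congr (_.[_]).
apply: eq_map_poly => c.
exact: etrans (gal_fix_alg x c) (esym (gal_fix_alg y c)).
Qed.

(** Evaluate the relation on powers of a generator, hence on all polynomials in
    it, and use the Lagrange polynomials. *)
Lemma conjugates_indep (c : 'I_n -> L) :
  (forall k : subvs_of K, \sum_i c i * h i (iota k) = 0) -> forall i, c i = 0.
Proof.
move=> c0 i; have [th _ xiE] : exists2 th, th \in fullv & xi = iota th.
  by apply/memv_imgP; rewrite iota_xi memv_adjoin.
have cp (p : {poly L}) : \sum_j c j * p.[r j] = 0.
  under eq_bigr do rewrite horner_coef mulr_sumr.
  rewrite exchange_big big1 // => s _ /=.
  under eq_bigr do rewrite mulrCA.
  rewrite -mulr_sumr (_ : \sum_j c j * r j ^+ s = 0) ?mulr0 //.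
  rewrite -[RHS](c0 (th ^+ s)); apply: eq_bigr => j _.
  by rewrite !rmorphXn /= -xiE.
have := cp (lagr (fun j => r j) i); rewrite (bigD1 i) //= big1 => [|j neji].
  move/eqP; rewrite addr0 mulf_eq0 (horner_lagr h_inj) eqxx orbF.
  by move/eqP.
have /eqP -> : (lagr (fun j => r j) i).[r j] == 0.
  by rewrite (horner_lagr h_inj).
exact: mulr0.
Qed.

(** All sets of a given size m are treated together, as the coefficients of one
    multi-affine function of k. *)
Lemma kummer_pminor a : kummer n (K * <[a]>)%VS ->
  forall S : {set 'I_n}, (0 < #|S| < n)%N -> pminor (phi a) S = 0.
Proof.
move=> kum S /andP[S_gt0 ltSn]; set m := #|S| in S_gt0 ltSn.
have [_ _ dimA] := csA.
suff c0 : forall T : {set 'I_n},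
    (if #|T| == m then pminor (phi a) T else 0) = 0.
  by have := c0 S; rewrite eqxx.
apply: (multiaffine_eq0 (K := subvs_of K) (s := fun i k => h i (iota k))).
- by move=> i x y; rewrite !linearD.
- exact: conjugates_indep.
move=> k; have := kum _ (memv_mul (valP k) (memv_line a)) m.
rewrite S_gt0 -ltnS prednK // => /(_ ltSn) /eqP.
rewrite /rho mulf_eq0 signr_eq0 /= => /eqP c0.
have := coef_char_poly_row_scale (fun i => h i (iota k)) (phi a) (ltnW ltSn).
have -> : \matrix_(i, j) (h i (iota k) * phi a i j) = phi (vsval k * a).
  rewrite rmorphM phi_diag -[RHS]/(_ *m _); apply/matrixP => i j.
  by rewrite mul_diag_mx !mxE.
rewrite -(red_char_polyE dimA galL split_phi) coef_map c0 /= scale0r.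
by move/esym/eqP; rewrite mulf_eq0 signr_eq0 => /eqP.
Qed.

Variable a : A.
Hypothesis nz_a : a != 0.
Hypothesis kummer_a : kummer n (K * <[a]>)%VS.

Lemma gal_support (g : gal_of {:L}) i j i' j' :
    g (r i) = r i' -> g (r j) = r j' ->
  (phi a i j == 0) = (phi a i' j' == 0).
Proof.
have [phiZ _] := split_phi.
have [th _ xiE] : exists2 th, th \in fullv & xi = iota th.
  by apply/memv_imgP; rewrite iota_xi memv_adjoin.
have phi_th : phi (vsval th) = diag_mx (\row_i r i) by rewrite phi_diag -xiE.
exact: (splitting_support_invariant h_inj phiZ phi_th phi_indep a
          (gal_fix_alg g) (gal_fix_min g)).
Qed.

(** Row i of the matrix is nonzero since some row is, and an automorphism that
    carries its index to i carries a nonzero entry to a nonzero entry. *)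
Lemma kummer_monomial : exists f : 'I_n -> 'I_n,
  (forall i j, (phi a i j != 0) = (j == f i)) /\
  (forall S : {set 'I_n}, S != set0 -> (forall i, i \in S -> f i \in S) ->
     S = setT).
Proof.
have [phiZ _] := split_phi.
apply: cyclic_pattern => //; last exact: kummer_pminor.
have /existsP[i1 /existsP[j1 aij]] : [exists i1, exists j1, phi a i1 j1 != 0].
  apply: contraNT nz_a; rewrite negb_exists => /forallP a0.
  apply/eqP/(diag_splitting_inj phiZ phi_indep); rewrite raddf0.
  apply/matrixP => i j; rewrite mxE.
  by have := a0 i; rewrite negb_exists => /forallP/(_ j); rewrite negbK => /eqP.
move=> i; pose g := ((h i1)^-1 * h i)%g.
have gi1 : g (r i1) = r i.
  have := galM (h i1) (h i1)^-1%g (memvf xi); rewrite mulgV gal_id => e.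
  by rewrite /g galM ?memvf // -e.
have [j gj] := gal_conjugate g j1.
by exists j; rewrite -(gal_support gi1 gj).
Qed.

End KummerLine.

(** * The generator of the Galois group *)

Lemma lreg_unit (F : fieldType) (A : falgType F) (a : A) :
  (forall x, a * x = 0 -> x = 0) -> a \is a GRing.unit.
Proof.
move=> la; have lE x : amull a x = a * x by rewrite /amull lfunE.
have /lker0P/lker0_lfunVK/(_ 1) : injective (amull a).
  by apply: raddf_inj => x; rewrite /= lE; apply: la.
rewrite lE; set x := ((amull a)^-1%VF 1) => ax.
apply/unitrP; exists x; split=> //.
apply/eqP; rewrite -subr_eq0; apply/eqP/la.
by rewrite mulrBr mulrA ax mul1r mulr1 subrr.
Qed.

Theorem theorem45 (F : fieldType) (A : falgType F) (n : nat)
    (K : {aspace A}) (L : splittingFieldType F)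
    (iota : 'AHom(subvs_of K, L)) (a : A)
    (hA : central_simple A n)
    (hK : maximal_subfield K)
    (hdim : \dim K = n)
    (hsep : separable 1 (limg iota))
    (hL : galois_closure (limg iota))
    (ha : a != 0)
    (hkummer : kummer n (K * <[a]>)%VS) :
  'Gal({:L} / limg iota)%g = 1%g /\
  exists g : gal_of {:L},
    [/\ #|'Gal({:L} / 1)%g| = n,
        'Gal({:L} / 1)%g = <[g]>%g,
        (exists u : A, KaK_generator iota a g u)
      & (a \is a GRing.unit -> KaK_generator iota a g a)].
Proof.
have [subK _] := hK; have [K1 K_comm K_unit] := subK.
have n_gt0 : (0 < n)%N by rewrite -hdim adim_gt0.
have [galL closL] := hL.
have iota_inj := subfield_ahom_inj (iota := iota) subK.
have dimE : \dim (limg iota) = n.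
  rewrite limg_dim_eq; last by rewrite (eqP (introT lker0P iota_inj)) capv0.
  by rewrite dimvf.
have aspE : is_aspace (limg iota).
  apply/andP; split; last by rewrite -aimgM limgS ?subvf.
  by apply: has_algid1; rewrite -(rmorph1 iota) memv_img ?memvf.
pose E : {subfield L} := ASpace aspE.
have [xi [h [iota_xi h_inj min_xi]]] :=
  primitive_conjugates (E := E) hsep galL dimE.
have [phi [split_phi phi_diag phi_ind]] :=
  subfield_diag_splitting subK n_gt0 hA hdim iota_xi h_inj min_xi.
have [f [a_f f_trans]] := kummer_monomial n_gt0 hA galL iota_xi h_inj
  min_xi split_phi phi_diag phi_ind ha hkummer.
(* Galois automorphisms act on the cycle i -> f i, hence commute with f. *)
have f_gal (g : gal_of {:L}) i i' :
    g (h i xi) = h i' xi -> g (h (f i) xi) = h (f i') xi.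
  move=> gi; have [j gj] := gal_conjugate min_xi g (f i).
  suff /eqP <- : j == f i' by [].
  have := gal_support iota_xi h_inj min_xi split_phi phi_diag phi_ind a gi gj.
  by move/(congr1 negb); rewrite !a_f eqxx => <-.
have [i1 xiE] : exists i1, h i1 xi = xi.
  have := root_minPoly 1%AS xi; rewrite min_xi rootE horner_prod.
  by case/prodf_eq0 => i _; rewrite !hornerE subr_eq0 => /eqP; exists i.
(* The indices on which x and y agree form a set stable under f. *)
have gal_xi (x y : gal_of {:L}) i : x xi = y xi -> x (h i xi) = y (h i xi).
  move=> xy.
  have := f_trans [set i | x (h i xi) == y (h i xi)] _ _.
  move=> /(_ _ _)/setP/(_ i); rewrite !inE => ST; apply/eqP/ST.
    by apply/set0Pn; exists i1; rewrite inE xiE xy.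
  move=> j; rewrite !inE => /eqP xyj.
  have [j' xj] := gal_conjugate min_xi x j.
  by rewrite (f_gal x j j') // (f_gal y j j') // -xyj.
(* An automorphism that fixes xi fixes all conjugates, so they lie in E. *)
have galE : galois 1 (limg iota).
  have galLE : galois (limg iota) {:L}.
    by apply: (galoisS (K := 1%AS) (M := E)); rewrite // sub1v subvf.
  have rE i : h i xi \in limg iota.
    rewrite -(galois_fixedField (K := E) galLE).
    apply/fixedFieldP; rewrite ?memvf // => x galx.
    suff /(gal_xi x 1%g)-> : x xi = (1%g : gal_of {:L}) xi by rewrite gal_id.
    rewrite gal_id.
    apply: (fixed_gal (K := E) _ galx); rewrite ?subvf //.
    by rewrite iota_xi memv_adjoin.
  suff : galois 1%AS E by [].
  apply/splitting_galoisField.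
  exists (minPoly 1 xi); rewrite minPolyOver; split=> //.
    rewrite min_xi -(big_map (fun i => h i xi) xpredT (fun x => 'X - x%:P)).
    by rewrite separable_prod_XsubC map_inj_uniq ?index_enum_uniq.
  exists [seq h i xi | i <- index_enum 'I_n].
    by rewrite min_xi big_map eqpxx.
  apply/eqP; rewrite eqEsubv; apply/andP; split.
    apply/Fadjoin_seqP; split; rewrite ?sub1v //.
    by move=> _ /mapP[i _ ->]; apply: rE.
  rewrite [X in (X <= _)%VS]iota_xi.
  apply/(FadjoinP (E := <<1 & _>>%AS)); split; first exact: sub1v.
  by apply: seqv_sub_adjoin; apply/mapP; exists i1; rewrite ?mem_index_enum.
have E_full : limg iota = fullv := closL E (subvv _) galE.
split.
  rewrite E_full; apply/trivgP/subsetP => x galx; rewrite inE.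
  apply/gal_eqP => z _; rewrite gal_id.
  exact: (fixed_gal (K := {:L}%AS) (subvv _) galx (memvf z)).
have cardG : #|'Gal({:L} / 1)%g| = n.
  by rewrite -(galois_dim galL) dimv1 divn1 -[RHS]dimE E_full.
have iotaP y : exists k, y = iota k.
  by have /memv_imgP[k _ ->] : y \in limg iota; [rewrite E_full memvf|exists k].
have gal_inj (x y : gal_of {:L}) : x xi = y xi -> x = y.
  move=> xy; apply/eqP/gal_eqP => z _; have [k ->] := iotaP z.
  exact: (gal_eq_generator iota_xi).
(* g moves i1, hence every index, one step along the cycle. *)
pose g := h (f i1); exists g.
have galG (x : gal_of {:L}) : x \in 'Gal({:L} / 1)%g.
  by rewrite gal_kHom ?sub1v // k1HomE ahomWin.
have genG : 'Gal({:L} / 1)%g = <[g]>%g.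
  apply/eqP; rewrite eqEsubset cycle_subG galG andbT.
  apply/subsetP => x _.
  have [j xj] := gal_conjugate min_xi x i1; rewrite xiE in xj.
  (* The indices reached from i1 by powers of g are stable under f. *)
  pose S := [set i | [exists y in <[g]>%g, y xi == h i xi]].
  have ST : S = setT.
    apply: f_trans.
      apply/set0Pn; exists i1; rewrite inE; apply/exists_inP.
      by exists 1%g; rewrite ?group1 // gal_id xiE.
    move=> i; rewrite !inE => /exists_inP[y gy /eqP yi].
    apply/exists_inP; exists (g * y)%g; first by rewrite groupM ?cycle_id.
    by rewrite galM ?memvf //; apply/eqP; apply: f_gal; rewrite xiE.
  have : j \in S by rewrite ST.
  rewrite inE => /exists_inP[y gy /eqP yj].
  by rewrite (gal_inj x y) // yj.
have a_comm k : exists k', iota k' = g (iota k) /\ a * vsval k = vsval k' * a.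
  have [k' gk] := iotaP (g (iota k)); exists k'; split=> //.
  have [phiZ _] := split_phi.
  apply: (diag_splitting_inj phiZ phi_ind); rewrite !rmorphM !phi_diag.
  rewrite -[LHS]/(_ *m _) -[RHS]/(_ *m _) mul_mx_diag mul_diag_mx.
  apply/matrixP => i j; rewrite !mxE -gk.
  have [->|aij] := eqVneq (phi a i j) 0; first by rewrite mul0r mulr0.
  rewrite mulrC; congr (_ * _).
  have := aij; rewrite a_f => /eqP ->.
  rewrite -galM ?memvf //; apply: (gal_eq_generator iota_xi).
  by rewrite galM ?memvf //; apply/esym/f_gal; rewrite xiE.
have Ua : a \is a GRing.unit.
  (* Row i of phi a * phi x is a nonzero multiple of row f i of phi x. *)
  have fS : f @: setT = setT.
    apply: f_trans => [|i _]; last by rewrite imset_f.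
    by apply/set0Pn; exists (f i1); rewrite imset_f.
  have [phiZ _] := split_phi.
  apply: lreg_unit => x /(congr1 phi); rewrite rmorphM raddf0 => ax0.
  apply: (diag_splitting_inj phiZ phi_ind); rewrite raddf0.
  apply/matrixP => j k; have /imsetP[i _ ->] : j \in f @: setT by rewrite fS.
  have /matrixP/(_ i k) := ax0; rewrite !mxE (bigD1 (f i)) //= big1 => [|l nel].
    move/eqP; rewrite addr0 mulf_eq0 => /orP[|/eqP //].
    by rewrite -[_ == 0]negbK a_f eqxx.
  by have := a_f i l; rewrite (negPf nel) => /negbFE/eqP->; rewrite mul0r.
have gen_a : KaK_generator iota a g a.
  have aKa : a \in (K * <[a]> * K)%VS.
    by have := memv_mul (memv_mul K1 (memv_line a)) K1; rewrite mul1r mulr1.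
  split=> // [|k]; last first.
    by have [k' [gk e]] := a_comm k; exists k'; split; rewrite // e mulrK.
  apply/eqP; rewrite eqEsubv; apply/andP; split; last first.
    by rewrite -{1}[(K * <[a]>)%VS]prodv1 prodvSr // -memvE.
  have aKS : (<[a]> * K <= K * <[a]>)%VS.
    apply/prodvP => _ x /vlineP[c ->] Kx; have [k' [_ e]] := a_comm (Subvs Kx).
    by rewrite -scalerAl [a * x]e memvZ // memv_mul ?memv_line ?subvsP.
  by rewrite -prodvA (subv_trans (prodvSr K aKS)) // prodvA prodv_id.
by split=> //; exists a.
Qed.
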